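(* Let $m$ be an integer with $m\ge2$. Then \[ f_m(\lfloor m/3\rfloor+1)>f_m(\lfloor m/3\rfloor+2)>\cdots>f_m(m)=1. \] That is, $f_m(r)>f_m(r+1)$ for every integer $r$ with $\lfloor m/3\rfloor+1\le r<m$, and $f_m(m)=1$.
   Context: For integers $m\ge 0$ and $r\ge 0$, $f_m(r)=2^{-r}\sum_{i=0}^r\binom{m}{i}$. *)

(* Defs.v *)
From mathcomp Require Import all_boot all_order all_algebra.

Set Implicit Arguments.
Unset Strict Implicit.
Unset Printing Implicit Defensive.

Import GRing.Theory Num.Theory.
Local Open Scope ring_scope.

Definition f (m r : nat) : rat :=
  2 ^- r * \sum_(0 <= i < r.+1) 'C(m, i)%:R.

(* Main.v *)
(** Clearing denominators, [f m r > f m r.+1] says that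
    [S r := \sum_(i <= r) 'C(m, i)] exceeds ['C(m, r.+1)], where
    [(r + 1) 'C(m, r.+1) = (m - r) 'C(m, r)]. If [m <= 2 r], then already
    ['C(m, r)] exceeds it. Otherwise write [S r = 'C(m, r) * (m - r) / Q r]; the
    claim becomes [Q r < r + 1]. Now [Q r.+1] is an increasing function of
    [Q r], and with [d := m - 2 r >= 0] the bound [Q r <= d + 2 r / (d + 2)]
    propagates by induction on [r] for fixed [m]; for [3 r > m], its right-hand
    side is less than [r + 1]. *)
Require Import Defs.
From mathcomp Require Import all_boot all_order all_algebra.
From mathcomp Require Import zify lra.
Import GRing.Theory Num.Theory.
Local Open Scope ring_scope.

(** The bound on [Q r] with denominators cleared; taking [m] as [d + 2 * r] avoids truncated
    subtraction. *)
Lemma sum_bin_lower (d r : nat) :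
  ((d + r) * (d + 2) * 'C(d + 2 * r, r)
   <= (\sum_(0 <= i < r.+1) 'C(d + 2 * r, i)) * (d * (d + 2) + 2 * r))%N.
Proof.
elim: r d => [|r IHr] d; first by rewrite big_nat1 !bin0; lia.
(* Lowering [r.+1] to [r] at fixed [m] raises [d] by 2. *)
have /= IH := IHr d.+2.
have Em : (d.+2 + 2 * r = d + 2 * r.+1)%N by lia.
rewrite Em in IH; rewrite big_nat_recr //=.
have := mul_bin_left (d + 2 * r.+1) r.
have -> : (d + 2 * r.+1 - r = d.+2 + r)%N by lia.
move: IH; set S := (\sum_(0 <= i < r.+1) _)%N.
set c := 'C(_, r.+1); set b := 'C(_, r) => IH bc.
pose P := ((d + 2) * (d + 4) + 2 * r)%N.
have {}IH : ((d + 4) * (r.+1 * c) <= S * P)%N by rewrite bc /P; lia.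
have P_gt0 : (0 < P)%N by rewrite /P; lia.
(* Scaling by [P] lets [IH] bound [S * P] below by a multiple of [c]; what remains is polynomial in
   [d] and [r]. *)
rewrite -(leq_pmul2r P_gt0).
have IHq := leq_mul IH (leqnn (d * (d + 2) + 2 * r.+1)).
have poly : ((d + r.+1) * (d + 2) * P
   <= ((d + 4) * r.+1 + P) * (d * (d + 2) + 2 * r.+1))%N by rewrite /P; nia.
have := leq_mul poly (leqnn c).
lia.
Qed.

Lemma bin_lt_sum (m r : nat) : (m < 3 * r)%N -> (r < m)%N ->
  ('C(m, r.+1) < \sum_(0 <= i < r.+1) 'C(m, i))%N.
Proof.
move=> lt_m3r lt_rm; have bc := mul_bin_left m r.
have b_gt0 : (0 < 'C(m, r))%N by rewrite bin_gt0 ltnW.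
have c_gt0 : (0 < 'C(m, r.+1))%N by rewrite bin_gt0.
have [le_m2r | /ltnW le_2rm] := leqP m (2 * r).
  rewrite big_nat_recr //=; apply: ltn_addl; nia.
have := sum_bin_lower (m - 2 * r) r.
have -> : (m - 2 * r + 2 * r = m)%N by lia.
have -> : (m - 2 * r + r = m - r)%N by lia.
rewrite mulnAC -bc; set d := (m - 2 * r)%N => bound.
have lt_q : (d * (d + 2) + 2 * r < r.+1 * (d + 2))%N.
  (* [m < 3 * r] enters here as [d <= r.-1]. *)
  have : (d * d <= d * r.-1)%N by rewrite leq_mul2l; lia.
  by lia.
rewrite ltnNge; apply/negP => le_Sc.
have := leq_trans bound (leq_mul le_Sc (leqnn _)).
by rewrite mulnAC mulnC leq_pmul2l // leqNgt lt_q.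
Qed.

Theorem theorem8 (m : nat) (hm : (2 <= m)%N) :
  (forall r : nat, (m %/ 3 + 1 <= r)%N -> (r < m)%N -> f m r > f m r.+1)
  /\ f m m = 1.
Proof.
split=> [r le_r lt_rm|]; rewrite /f -!natr_sum; last first.
  have -> : (\sum_(0 <= i < m.+1) 'C(m, i) = 2 ^ m)%N.
    rewrite big_mkord -addn1 -[2%N]/(1 + 1)%N expnDn.
    by rewrite addn1; apply: eq_bigr => i _; rewrite !exp1n !muln1.
  by rewrite natrX mulVf // expf_neq0.
have lt_m3r : (m < 3 * r)%N by lia.
have := bin_lt_sum _ _ lt_m3r lt_rm.
rewrite [in X in X < _]big_nat_recr //= natrD -(ltr_nat rat).
rewrite exprS invfM -mulrA mulrCA ltr_pM2l ?invr_gt0 ?exprn_gt0 //.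
lra.
Qed.
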